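(* Let $X$ be a complete metric space, $k\ge2$, and let $\mathcal{F}=\{f_1,\dots,f_k\}$ be a finite family of similitudes of $X$ with similarity ratios $c_1,\dots,c_k\in(0,1)$ and attractor $\mathcal{K}$. Let $\mathbf{\Gamma}=\{\Gamma_n\}_{n\in\mathbb{N}}$ be the natural fractal structure on $\mathcal{K}$ as a self-similar set. If $A\cap B$ is a finite set for all $A,B\in\Gamma_n$ with $A\neq B$ and each $n\in\mathbb{N}$, then $\mathcal{F}$ satisfies the level separation property LSP. Hence, the weak separation condition WSC holds.
   Context: A similitude of $(X,\rho)$ with ratio $c_i\in(0,1)$ is a map $f_i:X\to X$ with $\rho(f_i(x),f_i(y))=c_i\,\rho(x,y)$ for all $x,y\in X$. The attractor $\mathcal{K}\subseteq X$ is the unique nonempty compact set with $\mathcal{K}=\bigcup_{i=1}^k f_i(\mathcal{K})$. Let $\Sigma=\{1,\dots,k\}$; for $\mathbf{i}=i_1\cdots i_n\in\Sigma^n$ put $f_{\mathbf{i}}=f_{i_1}\circ\cdots\circ f_{i_n}$. The natural fractal structure on $\mathcal{K}$ is the sequence of coverings $\Gamma_n=\{f_{\mathbf{i}}(\mathcal{K}):\mathbf{i}\in\Sigma^n\}$, $n\in\mathbb{N}$; a set may appear more than once in a level, so $\Gamma_n$ is regarded as a family indexed by $\Sigma^n$, and $f_{\mathbf{i}}(\mathcal{K})$, $f_{\mathbf{j}}(\mathcal{K})$ are different elements of $\Gamma_n$ when $\mathbf{i}\ne\mathbf{j}$. LSP: for every $n$, (LSP1) any two different elements of $\Gamma_n$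 have disjoint interiors, and (LSP2) each element of $\Gamma_n$ has nonempty interior, interiors being taken in $\mathcal{K}$. WSC: $\mathbf{\Gamma}$ is irreducible, i.e. for each $n$ the covering $\Gamma_n$ of $\mathcal{K}$ has no proper subcovering (for every $\mathbf{i}\in\Sigma^n$, $\bigcup_{\mathbf{j}\in\Sigma^n,\,\mathbf{j}\neq\mathbf{i}}f_{\mathbf{j}}(\mathcal{K})\ne\mathcal{K}$).
   Formalization: The attractor K is additionally assumed not to be a single point; for a one-point attractor with k ≥ 2 (e.g. f_1 = f_2 = x/2 on the real line) all intersections are finite but both LSP and WSC fail. *)

(* Defs.v *)
From HB Require Import structures.
From mathcomp Require Import all_boot all_order all_algebra.
From mathcomp Require Import all_classical all_reals all_analysis.

Set Implicit Arguments.
Unset Strict Implicit.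
Unset Printing Implicit Defensive.

Import Order.TTheory GRing.Theory Num.Theory.
Import numFieldNormedType.Exports.

Local Open Scope classical_set_scope.
Local Open Scope ring_scope.

#[short(type="completeMetricType")]
HB.structure Definition CompleteMetric (R : numDomainType) :=
  {M of Metric R M & CompletePseudoMetric R M}.

Definition similitude (R : realType) (X : metricType R) (c : R) (f : X -> X) :=
  forall x y, mdist (f x) (f y) = c * mdist x y.

Definition is_attractor (T : topologicalType) (k : nat)
    (f : 'I_k -> T -> T) (K : set T) :=
  [/\ K !=set0, compact K & K = \bigcup_(i in [set: 'I_k]) f i @` K].

(* comp_word f [:: i1; ...; in] is f i1 \o ... \o f in, so i1 is applied
   last. *)
Definition comp_word (T : Type) (k : nat) (f : 'I_k -> T -> T)
    (w : seq 'I_k) : T -> T :=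
  foldr (fun i g => f i \o g) id w.

(* The level-n covering is kept as a family indexed by words of length n:
   equal sets with different indices are different elements of the level. *)
Definition Gamma (T : Type) (k : nat) (f : 'I_k -> T -> T) (K : set T)
    (n : nat) (w : n.-tuple 'I_k) : set T :=
  comp_word f w @` K.

(* Points outside K are isolated in [subspace K], hence the intersection
   with K. *)
Definition interior_in (T : topologicalType) (K A : set T) : set T :=
  K `&` ((A : set (subspace K))°).

Definition LSP (T : topologicalType) (k : nat) (f : 'I_k -> T -> T)
    (K : set T) :=
  forall n : nat,
    (forall v w : n.-tuple 'I_k, v != w ->
       interior_in K (Gamma f K v) `&` interior_in K (Gamma f K w) = set0) /\
    (forall w : n.-tuple 'I_k, interior_in K (Gamma f K w) !=set0).

Definition WSC (T : Type) (k : nat) (f : 'I_k -> T -> T) (K : set T) :=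
  forall (n : nat) (w : n.-tuple 'I_k),
    \bigcup_(v in [set v : n.-tuple 'I_k | v != w]) Gamma f K v <> K.

(* Main.v *)
(* A similar copy of a self-similar set which is not a singleton has at least
   two points, and K is covered by arbitrarily small copies of itself; hence K
   has no isolated point.  So every nonempty relatively open subset of K is
   infinite, and cannot lie in the finite intersection of two cells.  Each cell
   is itself infinite and meets the other cells of its level in a finite set
   only; the rest of it is the complement of finitely many compact sets, hence
   open in K, and witnesses both LSP2 and irreducibility. *)
Require Import Defs.
From mathcomp Require Import all_boot all_order all_algebra.
From mathcomp Require Import all_classical all_reals all_analysis.
Import Order.TTheory GRing.Theory Num.Theory.
Import numFieldNormedType.Exports.
Local Open Scope classical_set_scope.
Local Open Scope ring_scope.

(** Finite sets are closed in an accessible space, so if [U] met [E] in finitely many points,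
    deleting those other than [x] would leave a neighbourhood of [x] with no further point of
    [E]. *)
Lemma limit_point_nbhs_infinite (T : topologicalType) (E U : set T) (x : T) :
  accessible_space T -> limit_point E x -> nbhs x U -> infinite_set (U `&` E).
Proof.
move=> accT Ex xU finUE.
have clF : closed ((U `&` E) `\ x).
  by apply: (accessible_finite_set_closed.1 accT); exact: finite_setD.
have xF : nbhs x (~` ((U `&` E) `\ x)).
  by apply: open_nbhs_nbhs; split; [exact: closed_openC | case=> _ []].
have [y [/eqP yx Ey [Uy nFy]]] := Ex _ (filterI xU xF).
by apply: nFy.
Qed.

(** With its converse [interior_in_nbhs], this trades the subspace topology for neighbourhoods in
    the ambient space. *)
Lemma nbhs_interior_in (T : topologicalType) (K A U : set T) (x : T) :
  K x -> nbhs x U -> U `&` K `<=` A -> interior_in K A x.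
Proof.
move=> Kx xU UKA; split => //.
rewrite /interior /nbhs/= -nbhs_subspace_in//.
by apply: filterS xU => y Uy Ky; exact: UKA.
Qed.

Lemma interior_in_nbhs (T : topologicalType) (K A : set T) (x : T) :
  interior_in K A x -> exists2 U, nbhs x U & U `&` K `<=` A.
Proof.
move=> [Kx]; rewrite /interior /nbhs/= -nbhs_subspace_in// => KA.
by exists (fun y => K y -> A y) => // y [KAy Ky]; exact: KAy.
Qed.

Section metric.
Context {R : realType} {X : metricType R}.
Implicit Types (K : set X) (x y : X).

Lemma mdist_continuous x : continuous (mdist x : X -> R).
Proof.
move=> y; apply/cvgrPdist_lt => e e0.
near=> z.
have yz : mdist y z < e.
  near: z; have := nbhsx_ballx y e e0.
  by rewrite ballEmdist.
apply: le_lt_trans yz; rewrite ler_distl lerBlDr metric_triangle.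
by rewrite [mdist y z]metric_sym metric_triangle.
Unshelve. all: by end_near. Qed.

Lemma compact_mdist_bounded K : compact K ->
  exists M : R, forall x y, K x -> K y -> mdist x y <= M.
Proof.
move=> cK; have [->|/set0P[a Ka]] := eqVneq K set0; first by exists 0.
have [|b bK ab] := @compact_EVT_max _ _ (mdist a) K (ex_intro _ a Ka) cK.
  exact/continuous_subspaceT/mdist_continuous.
exists (mdist a b + mdist a b) => x y Kx Ky.
apply: le_trans (metric_triangle x a y) _.
by rewrite [mdist x a]metric_sym lerD// ab ?inE.
Qed.

Lemma similitude_continuous (c : R) (f : X -> X) :
  0 < c -> similitude c f -> continuous f.
Proof.
move=> c0 fc x U /nbhs_ballP[e /= e0 eU].
apply/nbhs_ballP; exists (e / c) => /=; first by rewrite divr_gt0.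
move=> y; rewrite ballEmdist/= ltr_pdivlMr// mulrC => xy; apply: eU.
by rewrite ballEmdist/= fc.
Qed.

Lemma similitude_injective (c : R) (f : X -> X) :
  0 < c -> similitude c f -> injective f.
Proof.
move=> c0 fc x y fxy; apply: mdist_positivity.
have /esym/eqP := fc x y; rewrite fxy mdistxx mulf_eq0 gt_eqF//= => /eqP.
exact.
Qed.

Context {k : nat} {f : 'I_k -> X -> X}.

(** The bound [q] is left free: a value below 1 makes long words contract uniformly, while [q = 1]
    suffices when only injectivity or continuity is wanted. *)
Lemma similitude_comp_word (c : 'I_k -> R) (q : R) (w : seq 'I_k) :
  (forall i, 0 < c i <= q) -> (forall i, similitude (c i) (f i)) ->
  exists2 r, 0 < r <= q ^+ size w & similitude r (comp_word f w).
Proof.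
move=> cq fc; elim: w => [|i w [r /andP[r0 rq] fr]] /=.
  by exists 1 => [|x y]; rewrite ?ltr01 ?expr0 ?lexx ?mul1r.
have /andP[ci0 ciq] := cq i.
exists (c i * r) => [|x y /=]; last by rewrite fc fr mulrA.
by rewrite mulr_gt0//= exprS ler_pM// ltW.
Qed.

Lemma attractor_Gamma_cover K n x : is_attractor f K -> K x ->
  exists w : n.-tuple 'I_k, Gamma f K w x.
Proof.
move=> [_ _ fK]; elim: n x => [|n IHn] x Kx; first by exists [tuple]; exists x.
move: Kx; rewrite {1}fK => -[i _ [y /IHn[w [z Kz <-]] <-]].
by exists [tuple of i :: w]; exists z.
Qed.

Lemma attractor_Gamma_sub K n (w : n.-tuple 'I_k) : is_attractor f K ->
  Gamma f K w `<=` K.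
Proof.
move=> [_ _ fK] _ [x Kx <-]; elim: (tval w) => //= i s Ks.
by rewrite fK; exists i => //; exists (comp_word f s x).
Qed.

Context {c : 'I_k -> R} {K : set X}.
Hypotheses (hc : forall i, 0 < c i < 1) (hf : forall i, similitude (c i) (f i)).
Hypotheses (hK : is_attractor f K) (hK1 : forall x : X, K <> [set x]).

Lemma attractor_limit_point : K `<=` limit_point K.
Proof.
move=> x Kx U /nbhs_ballP[e /= e0 eU].
(* The largest ratio; starting the maximum at 0 gives [0 <= q]. *)
have [q /andP[q0 q1] cq] : exists2 q : R, 0 <= q < 1 & forall i, 0 < c i <= q.
  exists (\big[Num.max/0]_i c i).
    apply/andP; split; first exact: bigmax_ge_id.
    by apply: bigmax_lt => // i _; have /andP[] := hc i.
  by move=> i; have /andP[-> _] := hc i; exact: le_bigmax.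
have [M KM] := compact_mdist_bounded _ (let: And3 _ cK _ := hK in cK).
have M0 : 0 <= M by rewrite -(mdistxx x) KM.
have [n qn] : exists n, q ^+ n * M < e.
  have /cvgrPdist_lt : (fun n => q ^+ n * M) @ \oo --> (0 : R).
    rewrite -[X in _ --> X](mul0r M); apply: cvgMl.
    by apply: cvg_expr; rewrite ger0_norm.
  move=> /(_ _ e0)[n _ /(_ n (leqnn n))] /=.
  by rewrite sub0r normrN => /(le_lt_trans (ler_norm _)); exists n.
have [w wx] := attractor_Gamma_cover _ n _ hK Kx; case: (wx) => z Kz zx.
have [r /andP[r0 rq] fr] := similitude_comp_word _ _ (val w) cq hf.
(* Here [x] is the image of [z] under the word [w]. The image of a second point [y] of [K] differs
   from [x] by injectivity and lies within [q ^+ n * M < e] of it. *)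
have [y Ky yz] : exists2 y, K y & y != z.
  apply: contrapT => K1; apply: (hK1 z); apply/seteqP; split=> [y Ky|_ ->//].
  by apply/eqP; apply: contrapT => /negP yz; apply: K1; exists y.
exists (comp_word f w y); split.
- apply: contra yz => /eqP; rewrite -zx => /(similitude_injective _ _ r0 fr).
  by move=> ->.
- by apply: (attractor_Gamma_sub _ _ w hK); exists y.
- apply: eU; rewrite ballEmdist/= -zx fr; apply: le_lt_trans qn.
  by rewrite size_tuple in rq; rewrite ler_pM ?mdist_ge0 ?KM// ltW.
Qed.

Let X_accessible : accessible_space X.
Proof. exact/hausdorff_accessible/metric_hausdorff. Qed.

Let hc1 i : 0 < c i <= 1.
Proof. by have /andP[-> /ltW] := hc i. Qed.

Lemma attractor_Gamma_infinite n (w : n.-tuple 'I_k) :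
  infinite_set (Gamma f K w).
Proof.
have [[x Kx] _ _] := hK.
have Kinf : infinite_set K.
  (* The whole space serves as the neighbourhood of a limit point; injectivity of the word map then
     carries infiniteness from [K] to the cell. *)
  have := limit_point_nbhs_infinite _ _ _ _ X_accessible
    (attractor_limit_point _ Kx) filterT.
  by rewrite setTI; apply; exact: nbhs_filter.
have [r /andP[r0 _] /(similitude_injective _ _ r0) fI] :=
  similitude_comp_word c 1 (val w) hc1 hf.
by rewrite /Gamma (eq_finite_set (inj_card_eq _))//; apply: in2W.
Qed.

Lemma attractor_Gamma_closed n (w : n.-tuple 'I_k) : closed (Gamma f K w).
Proof.
have [_ cK _] := hK.
have [r /andP[r0 _] /(similitude_continuous _ _ r0) fC] :=
  similitude_comp_word c 1 (val w) hc1 hf.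
apply: compact_closed; first exact: metric_hausdorff.
exact/continuous_compact/cK/continuous_subspaceT.
Qed.

Lemma interior_in_infinite (A : set X) :
  interior_in K A !=set0 -> infinite_set A.
Proof.
move=> [x Ax]; have [U xU] := interior_in_nbhs _ _ _ _ Ax.
move=> /sub_infinite_set; apply.
exact/(limit_point_nbhs_infinite _ _ _ _ X_accessible)/xU/attractor_limit_point/Ax.1.
Qed.

Hypothesis hfin : forall (n : nat) (v w : n.-tuple 'I_k), v != w ->
  finite_set (Gamma f K v `&` Gamma f K w).

(** Supplies a point of [K] lying in the cell of [w] and in no other cell of the level. *)
Lemma attractor_Gamma_private n (w : n.-tuple 'I_k) :
  Gamma f K w `\` \bigcup_(v in [set v : n.-tuple 'I_k | v != w]) Gamma f K v
    !=set0.
Proof.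
(* The other cells are infinite, but their traces on this one are finite. So [A \ B] is rewritten as
   [A \ (A & B)], through [(A \ A) | (A \ B)]. *)
apply: infinite_setN0; rewrite -[_ `\` _]set0U -[X in X `|` _](setDv (Gamma f K w)).
rewrite -setDIr setI_bigcupr.
apply: infinite_setD; first exact: attractor_Gamma_infinite.
by apply: bigcup_finite => [|v /= vw]; [exact: finite_finset | by apply: hfin; rewrite eq_sym].
Qed.

End metric.

(* The hypothesis that K is not a singleton is implicit in the source: for a
   one-point attractor both conclusions fail, since then all the f_w(K),
   w of length 1, coincide with K. *)
Theorem theorem9p3 (R : realType) (X : completeMetricType R)
    (k : nat) (hk : (2 <= k)%N)
    (f : 'I_k -> X -> X) (c : 'I_k -> R)
    (hc : forall i, 0 < c i < 1)
    (hf : forall i, similitude (c i) (f i))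
    (K : set X) (hK : is_attractor f K)
    (hK1 : forall x : X, K <> [set x])
    (hfin : forall (n : nat) (v w : n.-tuple 'I_k), v != w ->
       finite_set (Gamma f K v `&` Gamma f K w)) :
  LSP f K /\ WSC f K.
Proof.
split=> [n|n w wK]; last first.
  have [x [wx]] := attractor_Gamma_private hc hf hK hK1 hfin n w; rewrite wK.
  by apply; exact: attractor_Gamma_sub wx.
split=> [v w vw|w].
  apply/eqP/negP => /negP/set0P[x [xv xw]].
  have [U xU Uv] := interior_in_nbhs _ _ _ _ xv.
  have [V xV Vw] := interior_in_nbhs _ _ _ _ xw.
  (* A common interior point of the two cells is interior to their intersection, which is finite. *)
  apply: (interior_in_infinite hc hf hK hK1 _ _ (hfin n v w vw)).
  exists x; apply: nbhs_interior_in (filterI xU xV) _; first exact: xv.1.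
  by move=> y [[Uy Vy] Ky]; split; [exact: Uv | exact: Vw].
have [x [wx nvx]] := attractor_Gamma_private hc hf hK hK1 hfin n w.
(* The neighbourhood is the complement of the union of the other cells. Since the level covers [K],
   any point of [K] in it must lie in the cell of [w]. *)
exists x; apply: (nbhs_interior_in _ _ _ (~` _)).
- exact: attractor_Gamma_sub wx.
- apply: open_nbhs_nbhs; split; last exact: nvx.
  apply/closed_openC/closed_bigcup => [|v _]; first exact: finite_finset.
  exact: attractor_Gamma_closed hc hf hK n v.
- move=> y [nvy /(attractor_Gamma_cover _ n _ hK)[v vy]].
  by have [<-//|vw] := eqVneq v w; case: nvy; exists v.
Qed.
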